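(* Let $d,l\ge 1$ be integers, let $n_1,\dots,n_d$ be positive integers, and let $M\subset\mathcal{P}([d])$ be non-empty. If $A\subset[n_1]\times\dots\times[n_d]$ satisfies $\mathrm{c}_M(A)=l$, then there are at most $(|M|\,l^d)^l$ $l$-tuples $(S_1,\dots,S_l)$ such that each $S_i$ is an $M$-subspace and $A\subset S_1\cup\dots\cup S_l$.
   Context: $[k]=\{1,\dots,k\}$. For $B \subset [d]$, a $B$-subspace is a maximal subset $S$ of $[n_1]\times\dots\times[n_d]$ such that $x_i = y_i$ whenever $x,y\in S$ and $i \notin B$. For non-empty $M\subset\mathcal{P}([d])$, an $M$-subspace is a $B$-subspace for some $B\in M$. The $M$-covering number $\mathrm{c}_M(A)$ of $A\subset[n_1]\times\dots\times[n_d]$ is the smallest nonnegative integer $k$ such that $A$ is contained in a union of $k$ $M$-subspaces. *)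

(* Defs.v *)
From mathcomp Require Import all_boot.

Set Implicit Arguments.
Unset Strict Implicit.
Unset Printing Implicit Defensive.

(* The factor [k] = {1, .., k} is represented by 'I_k = {0, .., k-1}, and the
   coordinates 1, .., d by 'I_d. *)
Definition grid (d : nat) (n : 'I_d -> nat) : finType :=
  {dffun forall i : 'I_d, 'I_(n i)}.

Section Subspaces.

Variables (d : nat) (n : 'I_d -> nat).
Implicit Types (B : {set 'I_d}) (M : {set {set 'I_d}}) (S A : {set grid n}).

Definition agree_off B S : bool :=
  [forall x in S, forall y in S, forall i : 'I_d, (i \notin B) ==> (x i == y i)].

Definition is_subspace B S : bool := maxset (agree_off B) S.

Definition is_Msubspace M S : bool := [exists B in M, is_subspace B S].

Definition is_Mcover M A (k : nat) (s : k.-tuple {set grid n}) : bool :=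
  [forall i : 'I_k, is_Msubspace M (tnth s i)]
    && (A \subset \bigcup_(i < k) tnth s i).

Definition Mcoverable M A (k : nat) : bool :=
  [exists s : k.-tuple {set grid n}, is_Mcover M A s].

Lemma Mcoverable_ex M A : M != set0 -> exists k, Mcoverable M A k.
Proof.
case/set0Pn=> B BM; exists #|grid n|; apply/existsP.
have ex x : exists S, is_subspace B S && (x \in S).
  have agr : agree_off B [set x].
    apply/forall_inP=> y /set1P->; apply/forall_inP=> z /set1P->.
    by apply/forallP=> i; rewrite eqxx implybT.
  have [S maxS] := maxset_exists agr; rewrite sub1set => xS.
  by exists S; rewrite /is_subspace maxS.
pose f x := xchoose (ex x).
have fP x : is_subspace B (f x) && (x \in f x) := xchooseP (ex x).
exists [tuple f (enum_val i) | i < #|grid n|]; apply/andP; split.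
  apply/forallP=> i; rewrite tnth_mktuple; apply/exists_inP.
  by exists B => //; case/andP: (fP (enum_val i)).
apply/subsetP=> x _; apply/bigcupP; exists (enum_rank x) => //.
by rewrite tnth_mktuple enum_rankK; case/andP: (fP x).
Qed.

(* Non-emptiness of M is what makes the minimum range over a non-empty set. *)
Definition covering_number M (M_neq0 : M != set0) A : nat :=
  ex_minn (Mcoverable_ex A M_neq0).

End Subspaces.

(* Main.v *)
Require Import Defs.
From mathcomp Require Import all_boot.

Set Implicit Arguments.
Unset Strict Implicit.
Unset Printing Implicit Defensive.

(** Bounded search tree. If [A] cannot be covered by fewer than [k]
    [M]-subspaces and [k > 0], pick a point [a] of [A]. Some member [S_j] of
    any cover [(S_1, .., S_k)] contains [a], and [S_j] is determined by its type
    [B] in [M], which leaves [k * |M|] choices for [(j, B)]. The other members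
    cover [A \ S_j], which cannot be covered by fewer than [k - 1] subspaces.
    Iterating gives at most [(|M| * l) ^ l] covers of length [l = c_M(A)], and
    [l <= l ^ d]. *)

Lemma card_bigcup_leq (I T : finType) (P : {set I}) (F : I -> {set T}) (m : nat) :
  (forall i, i \in P -> #|F i| <= m) -> #|\bigcup_(i in P) F i| <= #|P| * m.
Proof.
move=> leFm; rewrite -sum_nat_const.
apply: (@leq_trans (\sum_(i in P) #|F i|)); last exact: leq_sum.
apply: (big_ind2 (fun (X : {set T}) k => #|X| <= k)) => [|X k Y h leX leY|//].
  by rewrite cards0.
by apply: leq_trans (leq_add leX leY); rewrite cardsU leq_subr.
Qed.

(** [unlift j i] is [None] exactly at [i = j], so [x] is the default of [oapp] and the entries of
    [t] fill the other positions in order. *)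
Definition tuple_insert (T : Type) (k : nat) (j : 'I_k.+1) (x : T)
    (t : k.-tuple T) : k.+1.-tuple T :=
  [tuple oapp (tnth t) x (unlift j i) | i < k.+1].

Definition tuple_remove (T : Type) (k : nat) (j : 'I_k.+1)
    (s : k.+1.-tuple T) : k.-tuple T :=
  [tuple tnth s (lift j i) | i < k].

Lemma tuple_removeK (T : Type) (k : nat) (j : 'I_k.+1) (s : k.+1.-tuple T) :
  tuple_insert j (tnth s j) (tuple_remove j s) = s.
Proof.
apply: eq_from_tnth => i; rewrite tnth_mktuple.
by case: unliftP => [i'|] -> //=; rewrite tnth_mktuple.
Qed.

Section SubspacesThroughPoints.

Variables (d : nat) (n : 'I_d -> nat).
Implicit Types (B : {set 'I_d}) (M : {set {set 'I_d}}) (S A : {set grid n}).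

(** Explicit equations for the [B]-subspace containing [a], replacing the description by
    maximality. *)
Definition subspace_through B (a : grid n) : {set grid n} :=
  [set x : grid n | [forall i : 'I_d, (i \notin B) ==> (x i == a i)]].

Lemma subspace_throughP B (a x : grid n) :
  reflect (forall i : 'I_d, i \notin B -> x i = a i)
          (x \in subspace_through B a).
Proof.
rewrite inE; apply: (iffP forallP) => [H i iB | H i].
  by apply/eqP; move: (H i); rewrite iB.
by apply/implyP => iB; apply/eqP; apply: H.
Qed.

Lemma agree_offP B S :
  reflect (forall x y : grid n, x \in S -> y \in S ->
             forall i : 'I_d, i \notin B -> x i = y i)
          (agree_off B S).
Proof.
apply: (iffP forall_inP) => [H x y xS yS i iB | H x xS].
  move/forall_inP: (H x xS) => /(_ y yS) /forallP /(_ i).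
  by rewrite iB => /eqP.
apply/forall_inP => y yS; apply/forallP => i; apply/implyP => iB.
by apply/eqP; apply: H.
Qed.

Lemma subspace_through_id B (a : grid n) : a \in subspace_through B a.
Proof. exact/subspace_throughP. Qed.

Lemma agree_off_subset_through B S (a : grid n) :
  agree_off B S -> a \in S -> S \subset subspace_through B a.
Proof.
move=> /agree_offP agrS aS; apply/subsetP => x xS.
by apply/subspace_throughP; apply: agrS.
Qed.

Lemma agree_off_through B (a : grid n) : agree_off B (subspace_through B a).
Proof.
apply/agree_offP => x y /subspace_throughP xa /subspace_throughP ya i iB.
by rewrite xa // ya.
Qed.

Lemma is_subspace_through B (a : grid n) : is_subspace B (subspace_through B a).
Proof.
apply/maxsetP; split=> [|S agrS sub]; first exact: agree_off_through.
apply/eqP; rewrite eqEsubset sub andbT.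
apply: agree_off_subset_through => //.
exact: subsetP sub _ (subspace_through_id B a).
Qed.

(** Agreement off [B] puts [S] inside [subspace_through B a], and maximality of [S] forces equality.
    Hence a type and a point determine a subspace. *)
Lemma is_subspace_eq_through B S (a : grid n) :
  is_subspace B S -> a \in S -> S = subspace_through B a.
Proof.
case/maxsetP => agrS maxS aS.
by rewrite -(maxS _ (agree_off_through B a) (agree_off_subset_through agrS aS)).
Qed.

Lemma is_McoverP M A (k : nat) (s : k.-tuple {set grid n}) :
  reflect ((forall i, is_Msubspace M (tnth s i)) /\
           (forall x, x \in A -> exists i, x \in tnth s i))
          (is_Mcover M A s).
Proof.
apply: (iffP andP) => [[/forallP sM /subsetP sA] | [sM sA]]; split=> //.
- by move=> x /sA /bigcupP[i _ xi]; exists i.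
- exact/forallP.
by apply/subsetP => x /sA [i xi]; apply/bigcupP; exists i.
Qed.

Lemma is_Mcover_remove M A (k : nat) (j : 'I_k.+1)
    (s : k.+1.-tuple {set grid n}) :
  is_Mcover M A s -> is_Mcover M (A :\: tnth s j) (tuple_remove j s).
Proof.
case/is_McoverP => sM sA; apply/is_McoverP; split=> [i|x].
  by rewrite tnth_mktuple.
case/setDP => /sA[i xi] xj.
case: (unliftP j i) xi => [i'|] -> xi; last by rewrite xi in xj.
by exists i'; rewrite tnth_mktuple.
Qed.

(** Putting [S] in front of a cover of the rest covers [A]. So removing one subspace lowers the
    covering number by at most one. *)
Lemma Mcoverable_setD M A S (k : nat) :
  is_Msubspace M S -> Mcoverable M (A :\: S) k -> Mcoverable M A k.+1.
Proof.
move=> SM /existsP[t /is_McoverP[tM tA]].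
apply/existsP; exists [tuple of S :: t]; apply/is_McoverP; split=> [i|x xA].
  by case: (unliftP ord0 i) => [i'|] -> //; rewrite tnthS.
case: (boolP (x \in S)) => [xS|xS]; first by exists ord0.
have [|i xi] := tA x; first by rewrite inE xS.
by exists (lift ord0 i); rewrite tnthS.
Qed.

(** The bound [m] stays fixed while [k] decreases in the induction. Only a lower bound on cover
    lengths is assumed, since this is what passes to [A :\: S]. *)
Lemma card_Mcover_leq M (m k : nat) A :
  k <= m -> (forall j, Mcoverable M A j -> k <= j) ->
  #|[set s : k.-tuple {set grid n} | is_Mcover M A s]| <= (#|M| * m) ^ k.
Proof.
elim: k A => [|k IH] A lekm minA.
  by rewrite expn0 (leq_trans (max_card _)) // card_tuple expn0.
have [a aA] : exists a, a \in A.
  apply/set0Pn/eqP => A0.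
  (* The empty tuple would cover an empty [A], giving [k.+1 <= 0]. *)
  suff /minA : Mcoverable M A 0 by [].
  apply/existsP; exists [tuple]; apply/is_McoverP; split=> [[]//|x].
  by rewrite A0 inE.
pose T B := subspace_through B a.
(* For [p = (j, B)], [F p] contains every cover of [A] whose [j]-th member is [T B]. *)
pose F (p : 'I_k.+1 * {set 'I_d}) :=
  [set tuple_insert p.1 (T p.2) t
     | t : k.-tuple _ in [set t | is_Mcover M (A :\: T p.2) t]].
apply: (@leq_trans #|\bigcup_(p in setX [set: 'I_k.+1] M) F p|).
  apply/subset_leq_card/subsetP => s; rewrite inE => cov_s.
  have /is_McoverP[sM sA] := cov_s.
  have [j aj] := sA a aA; have /exists_inP[B BM subB] := sM j.
  have eqT := is_subspace_eq_through subB aj.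
  apply/bigcupP; exists (j, B); first by rewrite !inE.
  apply/imsetP; exists (tuple_remove j s); rewrite /= /T -eqT ?tuple_removeK //.
  by rewrite inE is_Mcover_remove.
apply: (@leq_trans (#|setX [set: 'I_k.+1] M| * (#|M| * m) ^ k)); last first.
  (* There are [k.+1 * #|M|] branches, and [k.+1 <= m]. *)
  by rewrite cardsX cardsT card_ord expnS leq_mul // mulnC leq_mul.
apply: card_bigcup_leq => -[j B]; rewrite !inE /= => BM.
apply: leq_trans (leq_imset_card _ _) _; apply: IH => [|i covi].
  exact: ltnW.
rewrite -ltnS; apply: minA; apply: Mcoverable_setD covi.
by apply/exists_inP; exists B => //; apply: is_subspace_through.
Qed.

End SubspacesThroughPoints.

Theorem theorem2p5 (d l : nat) (d_gt0 : 0 < d) (l_gt0 : 0 < l)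
    (n : 'I_d -> nat) (n_gt0 : forall i : 'I_d, 0 < n i)
    (M : {set {set 'I_d}}) (M_neq0 : M != set0)
    (A : {set grid n}) (cA : covering_number M_neq0 A = l) :
  #|[set s : l.-tuple {set grid n} | is_Mcover M A s]| <= (#|M| * l ^ d) ^ l.
Proof.
(* Taking [m = l ^ d] is allowed because [l ^ 1 <= l ^ d]. *)
apply: card_Mcover_leq; first by rewrite -[X in X <= _]expn1 leq_pexp2l.
by move: cA; rewrite /covering_number; case: ex_minnP => k _ mink <-.
Qed.
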